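(* For $K>2$ let $r^*(K)\in(0,1)$ denote the synchronization level on the bifurcation line as a function of $K$, i.e. the solution $r=r^*(K)$ of $$V(f_r(K)\,r)=r,\qquad f_r(K)=K-\sqrt{K^2-\frac{2K}{1-r^2}},\qquad r\in(0,1),\ K>\frac{2}{1-r^2}.$$ Then: 1. $\lim_{K\downarrow2}r^*(K)=0$. 2. $\lim_{K\to\infty}r^*(K)=1$. 3. $r^*(K)\sim\sqrt{\frac{K-2}{2}}$ as $K\downarrow2$. 4. $1-r^*(K)\sim\frac{1}{2\sqrt K}$ as $K\to\infty$. 5. $\frac{\partial r^*(K)}{\partial K}>0$ for all $K>2$. 6. $\frac{\partial^2r^*(K)}{\partial K^2}<0$ for all $K>2$.
   Context: $V:\mathbb{R}\to\mathbb{R}$ is defined by $$V(x)=\frac{\int_0^{2\pi}\cos\theta\,e^{x\cos\theta}\,d\theta}{\int_0^{2\pi}e^{x\cos\theta}\,d\theta}.$$ The notation $a\sim b$ means that the ratio $a/b$ tends to $1$ in the indicated limit. Origin of the defining equation: on the bifurcation line of the equations $r_1=V(Kr_1+Lr_2)$, $r_2=V(Kr_2+Lr_1)$ with $L<0$, where solutions with $r_1\neq r_2$ branch off from the symmetric solution $r_1=r_2=r^*>0$, one has $r^*=V((K+L)r^* )$ and $r^*=\sqrt{1-\frac{2K}{K^2-L^2}}$. Eliminating $L$ by $L=-\sqrt{K^2-\frac{2K}{1-(r^* )^2}}$ gives the equation that defines $r^*(K)$. *)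

(* Defs.v *)
From Stdlib Require Import Reals.
From Coquelicot Require Import Coquelicot.

Local Open Scope R_scope.

Definition V (x : R) : R :=
  RInt (fun theta => cos theta * exp (x * cos theta)) 0 (2 * PI) /
  RInt (fun theta => exp (x * cos theta)) 0 (2 * PI).

(* The effective coupling K + L on the bifurcation line, after eliminating
   L = - sqrt (K^2 - 2K / (1 - r^2)). *)
Definition f (r K : R) : R := K - sqrt (K ^ 2 - 2 * K / (1 - r ^ 2)).

Definition sync_level (K r : R) : Prop :=
  0 < r < 1 /\ K > 2 / (1 - r ^ 2) /\ V (f r K * r) = r.

(* a ~ b along the filter F; only used where b is nonzero near the limit. *)
Definition asymp_equiv (F : (R -> Prop) -> Prop) (a b : R -> R) : Prop :=
  filterlim (fun K => a K / b K) F (locally 1).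

(* Main.v *)
Require Import Defs.
From Stdlib Require Import Reals Lra Psatz Ranalysis5.
From Coquelicot Require Import Coquelicot.
Local Open Scope R_scope.

(** Integration by parts gives the Riccati equation V' = 1 - V^2 - V/x. Put
    v = V x, q = 1 - v^2 and let s = x V'/V = x q / v - 1 be the logarithmic slope
    of V. Solving the equation of the bifurcation line for K along r = V x, x > 0,
    gives K = (1 + s)^2 / (2 q s), and x s' = (1 + s) (q (1 + s) - 2 s) / q. Hence
    dK/dx and d^2r/dK^2 have the signs of explicit polynomials in q and s. Comparison
    arguments for the Riccati equation confine s, as a function of q, between
    (q + q^2) / 2 and the minimum of q and q/2 + q^2/2 + q^3 + 10 q^4, which is sharp
    enough at both ends (s ~ 1 - v^2 as x -> 0 and s = q/2 + q^2/2 + O(q^3) as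
    x -> oo) to decide these signs and to read off the asymptotics. *)

Ltac positivity :=
  repeat match goal with
  | |- 0 < _ * _ => apply Rmult_lt_0_compat
  | |- 0 < _ / _ => apply Rdiv_lt_0_compat
  | |- 0 < _ ^ _ => apply pow_lt
  end; trivial; lra.

(** * The Bessel quotient V and its Riccati equation *)

(** This is 2 pi times the [k]-th derivative of the modified Bessel function I_0, so [V] is I_1 /
    I_0. *)
Definition cosexp_integral (k : nat) (x : R) : R :=
  RInt (fun t => cos t ^ k * exp (x * cos t)) 0 (2 * PI).

Lemma continuous_cosexp (k : nat) (x t : R) :
  continuous (fun t => cos t ^ k * exp (x * cos t)) t.
Proof.
apply (ex_derive_continuous (fun t => cos t ^ k * exp (x * cos t))).
auto_derive; trivial.
Qed.

Lemma ex_RInt_cosexp (k : nat) (x a b : R) :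
  ex_RInt (fun t => cos t ^ k * exp (x * cos t)) a b.
Proof.
apply (ex_RInt_continuous (V := R_CompleteNormedModule)).
intros t _; apply continuous_cosexp.
Qed.

Lemma is_derive_cosexp_integral (k : nat) (x : R) :
  is_derive (cosexp_integral k) x (cosexp_integral (S k) x).
Proof.
assert (D : forall y t, is_derive (fun y => cos t ^ k * exp (y * cos t)) y
                          (cos t ^ S k * exp (y * cos t))).
{ intros y t; auto_derive; trivial; simpl; ring. }
replace (cosexp_integral (S k) x)
  with (RInt (fun t => Derive (fun y => cos t ^ k * exp (y * cos t)) x) 0 (2 * PI)).
- apply is_derive_RInt_param.
  + apply filter_forall; intros y t _; eexists; apply D.
  + intros t _.
    apply (continuity_2d_pt_ext (fun y t => cos t ^ S k * exp (y * cos t))).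
    { intros y t'; symmetry; apply is_derive_unique, D. }
    assert (C : continuity_2d_pt (fun _ t => cos t) x t).
    { apply (continuity_1d_2d_pt_comp cos (fun _ t => t)).
      - apply continuity_cos.
      - apply continuity_2d_pt_id2. }
    apply continuity_2d_pt_mult.
    * apply (continuity_1d_2d_pt_comp (fun c => c ^ S k) (fun _ t => cos t)); trivial.
      apply derivable_continuous_pt, derivable_pt_pow.
    * apply (continuity_1d_2d_pt_comp exp (fun y t => y * cos t)).
      { apply derivable_continuous_pt, derivable_pt_exp. }
      apply continuity_2d_pt_mult; trivial.
      apply continuity_2d_pt_id1.
  + apply filter_forall; intros y; apply ex_RInt_cosexp.
- apply RInt_ext; intros t _; apply is_derive_unique, D.
Qed.

Lemma cosexp_integral0_gt0 (x : R) : 0 < cosexp_integral 0 x.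
Proof.
pose proof PI_RGT_0.
apply RInt_gt_0; try lra.
- intros t _; simpl; rewrite Rmult_1_l; apply exp_pos.
- intros t _; apply continuous_cosexp.
Qed.

Lemma cos_lt_1 (t : R) : 0 < t < 2 * PI -> cos t < 1.
Proof.
intros Ht.
replace t with (2 * (t / 2)) by field.
rewrite cos_2a_sin.
assert (0 < sin (t / 2)) by (apply sin_gt_0; lra).
nra.
Qed.

Lemma cosexp_integral1_lt (x : R) : cosexp_integral 1 x < cosexp_integral 0 x.
Proof.
pose proof PI_RGT_0.
apply RInt_lt; try lra; try (intros; apply continuous_cosexp).
intros t Ht; simpl.
pose proof (cos_lt_1 t Ht); pose proof (exp_pos (x * cos t)); nra.
Qed.

Definition sinexp_integral (x : R) : R :=
  RInt (fun t => sin t ^ 2 * exp (x * cos t)) 0 (2 * PI).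

Lemma continuous_sinexp (x t : R) :
  continuous (fun t => sin t ^ 2 * exp (x * cos t)) t.
Proof.
apply (ex_derive_continuous (fun t => sin t ^ 2 * exp (x * cos t))).
auto_derive; trivial.
Qed.

Lemma ex_RInt_sinexp (x a b : R) :
  ex_RInt (fun t => sin t ^ 2 * exp (x * cos t)) a b.
Proof.
apply (ex_RInt_continuous (V := R_CompleteNormedModule)).
intros t _; apply continuous_sinexp.
Qed.

Lemma sinexp_integral_gt0 (x : R) : 0 < sinexp_integral x.
Proof.
pose proof PI_RGT_0.
unfold sinexp_integral.
(* The sine vanishes at the interior point [PI], so strict positivity comes from the first half
   alone; the second half is only shown nonnegative. *)
rewrite <- (RInt_Chasles (V := R_CompleteNormedModule) _ 0 PI (2 * PI));
  try apply ex_RInt_sinexp.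
assert (0 < RInt (fun t => sin t ^ 2 * exp (x * cos t)) 0 PI).
{ apply RInt_gt_0; try lra; try (intros; apply continuous_sinexp).
  intros t Ht; pose proof (sin_gt_0 t); pose proof (exp_pos (x * cos t)).
  apply Rmult_lt_0_compat; trivial; apply pow_lt; lra. }
assert (0 <= RInt (fun t => sin t ^ 2 * exp (x * cos t)) PI (2 * PI)).
{ apply RInt_ge_0; try lra; try apply ex_RInt_sinexp.
  intros t _; pose proof (exp_pos (x * cos t)).
  apply Rmult_le_pos; try lra; apply pow2_ge_0. }
unfold plus; simpl in *; lra.
Qed.

Lemma sinexp_integral_eq (x : R) :
  sinexp_integral x = cosexp_integral 0 x - cosexp_integral 2 x.
Proof.
unfold cosexp_integral, sinexp_integral.
rewrite <- (RInt_minus (V := R_CompleteNormedModule)); try apply ex_RInt_cosexp.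
apply RInt_ext; intros t _.
unfold minus, plus, opp; simpl.
pose proof (sin2_cos2 t) as E; unfold Rsqr in E.
replace (sin t * (sin t * 1)) with (1 - cos t * cos t) by lra; ring.
Qed.

(* Integration by parts, with [- sin t * exp (x * cos t)] as the primitive that
   vanishes at both ends. *)
Lemma cosexp_integral1_eq (x : R) :
  cosexp_integral 1 x = x * (cosexp_integral 0 x - cosexp_integral 2 x).
Proof.
rewrite <- sinexp_integral_eq.
assert (H : is_RInt (fun t => minus (x * (sin t ^ 2 * exp (x * cos t)))
                                    (cos t ^ 1 * exp (x * cos t)))
              0 (2 * PI) (minus (- sin (2 * PI) * exp (x * cos (2 * PI)))
                                (- sin 0 * exp (x * cos 0)))).
{ apply (is_RInt_derive (fun t => - sin t * exp (x * cos t))).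
  - intros t _; auto_derive; trivial; unfold minus, plus, opp; simpl; ring.
  - intros t _.
    apply (ex_derive_continuous
      (fun t => minus (x * (sin t ^ 2 * exp (x * cos t))) (cos t ^ 1 * exp (x * cos t)))).
    unfold minus, plus, opp; simpl; auto_derive; trivial. }
apply (is_RInt_unique (V := R_CompleteNormedModule)) in H.
rewrite (RInt_minus (V := R_CompleteNormedModule)) in H.
- assert (E : RInt (fun t => x * (sin t ^ 2 * exp (x * cos t))) 0 (2 * PI)
              = x * sinexp_integral x).
  { apply (RInt_scal (V := R_CompleteNormedModule)), ex_RInt_sinexp. }
  rewrite E, sin_2PI, sin_0 in H.
  unfold minus, plus, opp in H; simpl in H; unfold cosexp_integral; simpl; lra.
- apply (ex_RInt_scal (V := R_NormedModule)); apply ex_RInt_sinexp.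
- apply ex_RInt_cosexp.
Qed.

Lemma V_eq (x : R) : V x = cosexp_integral 1 x / cosexp_integral 0 x.
Proof.
unfold V, cosexp_integral; f_equal;
  apply RInt_ext; intros t _; simpl; ring.
Qed.

Lemma V_lt_1 (x : R) : V x < 1.
Proof.
rewrite V_eq; pose proof (cosexp_integral0_gt0 x).
apply Rlt_div_l; trivial; rewrite Rmult_1_l; apply cosexp_integral1_lt.
Qed.

(** The integrand of [cosexp_integral 1] changes sign; integration by parts replaces it by [x] times
    a nonnegative one. *)
Lemma V_gt_0 (x : R) : 0 < x -> 0 < V x.
Proof.
intros Hx; rewrite V_eq, cosexp_integral1_eq, <- sinexp_integral_eq.
apply Rdiv_lt_0_compat; [|apply cosexp_integral0_gt0].
apply Rmult_lt_0_compat; trivial; apply sinexp_integral_gt0.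
Qed.

Lemma V_0 : V 0 = 0.
Proof.
rewrite V_eq, cosexp_integral1_eq, Rmult_0_l; apply Rdiv_0_l.
Qed.

(** This form of the derivative is also valid at [x = 0], where the Riccati form divides by zero; it
    supplies continuity of [V] there. *)
Lemma is_derive_V_aux (x : R) :
  is_derive V x (cosexp_integral 2 x / cosexp_integral 0 x - V x ^ 2).
Proof.
apply (is_derive_ext (fun x => cosexp_integral 1 x / cosexp_integral 0 x)).
{ intros y; symmetry; apply V_eq. }
pose proof (cosexp_integral0_gt0 x).
rewrite V_eq.
evar_last.
{ apply is_derive_div; [apply is_derive_cosexp_integral..|lra]. }
simpl; field; lra.
Qed.

Lemma is_derive_V (x : R) : x <> 0 -> is_derive V x (1 - V x ^ 2 - V x / x).
Proof.
intros Hx.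
evar_last; [apply is_derive_V_aux|].
assert (E : V x / x = 1 - cosexp_integral 2 x / cosexp_integral 0 x).
{ pose proof (cosexp_integral0_gt0 x).
  rewrite V_eq, cosexp_integral1_eq; field; lra. }
simpl in *; lra.
Qed.

(** * Comparison principle *)

(** Barrier principle: the sign of the derivative has to be checked only at points where the claimed
    bound fails. *)
Lemma nonpos_of_derive_neg (D D' : R -> R) :
  (forall x, 0 <= x -> continuity_pt D x) ->
  (forall x, 0 < x -> is_derive D x (D' x)) ->
  D 0 <= 0 -> (forall x, 0 < x -> 0 < D x -> D' x < 0) ->
  forall x, 0 < x -> D x <= 0.
Proof.
intros Hc Hd H0 Hneg x Hx.
destruct (Rle_or_lt (D x) 0) as [|HDx]; trivial; exfalso.
(* At a positive maximum of [D] on [0, x] the derivative cannot be negative. *)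
destruct (continuity_ab_maj D 0 x) as [m [Hmax Hm]]; [lra|intros; apply Hc; lra|].
assert (HDm : 0 < D m) by (specialize (Hmax x); lra).
assert (Hm0 : 0 < m) by (destruct (Req_dec m 0); [subst; lra|lra]).
pose proof (Hneg m Hm0 HDm) as Hn.
pose proof (Hd m Hm0) as Dm.
apply is_derive_Reals in Dm.
destruct (Dm (- D' m / 2) ltac:(lra)) as [d Hdelta].
pose proof (cond_pos d) as Hdpos.
(* The difference quotient is taken to the left, since [m] may be the right endpoint; [h <= m] keeps
   [m - h] in the interval. *)
set (h := Rmin m (d / 2)).
assert (Hh : 0 < h) by (apply Rmin_glb_lt; lra).
assert (Hhm : h <= m) by apply Rmin_l.
assert (Hhd : h <= d / 2) by apply Rmin_r.
specialize (Hdelta (- h) ltac:(lra)).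
rewrite Rabs_Ropp, Rabs_pos_eq in Hdelta by lra.
specialize (Hdelta ltac:(lra)).
apply Rabs_def2 in Hdelta.
specialize (Hmax (m + - h) ltac:(lra)).
assert (0 <= (D (m + - h) - D m) / - h).
{ replace ((D (m + - h) - D m) / - h) with ((D m - D (m + - h)) / h) by (field; lra).
  apply Rdiv_le_0_compat; lra. }
lra.
Qed.

Lemma continuity_pt_V (x : R) : continuity_pt V x.
Proof.
apply continuity_pt_filterlim, (ex_derive_continuous V).
eexists; apply is_derive_V_aux.
Qed.

Lemma V_nonneg (x : R) : 0 <= x -> 0 <= V x < 1.
Proof.
intros Hx; split; [|apply V_lt_1].
destruct (Req_dec x 0) as [->|]; [rewrite V_0; lra|].
apply Rlt_le, V_gt_0; lra.
Qed.

Section Comparison.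

Variables Phi dPhi : R -> R.
Hypothesis Phi_derive : forall v, 0 <= v < 1 -> is_derive Phi v (dPhi v).
Hypothesis Phi_0 : Phi 0 = 0.

Lemma continuity_pt_Phi_V (x : R) : 0 <= x -> continuity_pt (fun x => Phi (V x)) x.
Proof.
intros Hx.
apply (continuity_pt_comp V Phi); [apply continuity_pt_V|].
apply continuity_pt_filterlim, (ex_derive_continuous Phi).
eexists; apply Phi_derive, V_nonneg, Hx.
Qed.

Lemma is_derive_Phi_V (x : R) : 0 < x ->
  is_derive (fun x => Phi (V x)) x (dPhi (V x) * (1 - V x ^ 2 - V x / x)).
Proof.
intros Hx.
evar_last.
{ apply (is_derive_comp Phi V); [apply Phi_derive, V_nonneg; lra|].
  apply is_derive_V; lra. }
unfold scal; simpl; unfold mult; simpl; ring.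
Qed.

(** [Phi] is a candidate inverse of [V]. Comparing [Phi (V x)] with [x] bounds [x], and hence the
    logarithmic slope, by a function of [V x] alone. *)
Lemma Phi_V_le :
  (forall x, 0 < x -> x < Phi (V x) -> dPhi (V x) * (1 - V x ^ 2 - V x / x) < 1) ->
  forall x, 0 < x -> Phi (V x) <= x.
Proof.
intros H x Hx; apply Rminus_le_0.
assert (Phi (V x) - x <= 0); [|lra]; revert x Hx.
apply (nonpos_of_derive_neg (fun x => Phi (V x) - x)
  (fun x => dPhi (V x) * (1 - V x ^ 2 - V x / x) - 1)).
- intros x Hx; apply continuity_pt_minus; [now apply continuity_pt_Phi_V|].
  apply continuity_pt_id.
- intros x Hx; apply (is_derive_minus (V := R_NormedModule) (fun x => Phi (V x)) (fun x => x)).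
  + now apply is_derive_Phi_V.
  + apply (is_derive_id (K := R_AbsRing)).
- rewrite V_0, Phi_0; lra.
- intros x Hx HD; specialize (H x Hx); lra.
Qed.

Lemma Phi_V_ge :
  (forall x, 0 < x -> Phi (V x) < x -> 1 < dPhi (V x) * (1 - V x ^ 2 - V x / x)) ->
  forall x, 0 < x -> x <= Phi (V x).
Proof.
intros H x Hx.
assert (x - Phi (V x) <= 0); [|lra]; revert x Hx.
apply (nonpos_of_derive_neg (fun x => x - Phi (V x))
  (fun x => 1 - dPhi (V x) * (1 - V x ^ 2 - V x / x))).
- intros x Hx; apply continuity_pt_minus; [|now apply continuity_pt_Phi_V].
  apply continuity_pt_id.
- intros x Hx; apply (is_derive_minus (V := R_NormedModule) (fun x => x) (fun x => Phi (V x))).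
  + apply (is_derive_id (K := R_AbsRing)).
  + now apply is_derive_Phi_V.
- rewrite V_0, Phi_0; lra.
- intros x Hx HD; specialize (H x Hx); lra.
Qed.

End Comparison.

(** * Bounds on the logarithmic slope *)

Definition log_slope (x : R) : R := x * (1 - V x ^ 2) / V x - 1.

Lemma V_mul_log_slope (x : R) : 0 < x -> V x * (1 + log_slope x) = x * (1 - V x ^ 2).
Proof.
intros Hx; pose proof (V_gt_0 x Hx); unfold log_slope; field; lra.
Qed.

Lemma le_log_slope (x a : R) : 0 < x ->
  V x * (1 + a) / (1 - V x ^ 2) <= x -> a <= log_slope x.
Proof.
intros Hx H; pose proof (V_gt_0 x Hx); pose proof (V_lt_1 x).
unfold log_slope.
assert (Hq : 0 < 1 - V x ^ 2) by nra.
apply Rle_div_l in H; trivial.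
assert (1 + a <= x * (1 - V x ^ 2) / V x); [|lra].
apply Rle_div_r; trivial; lra.
Qed.

Lemma log_slope_le (x a : R) : 0 < x ->
  x <= V x * (1 + a) / (1 - V x ^ 2) -> log_slope x <= a.
Proof.
intros Hx H; pose proof (V_gt_0 x Hx); pose proof (V_lt_1 x).
unfold log_slope.
assert (Hq : 0 < 1 - V x ^ 2) by nra.
apply Rle_div_r in H; trivial.
assert (x * (1 - V x ^ 2) / V x <= 1 + a); [|lra].
apply Rle_div_l; trivial; lra.
Qed.

Lemma ratio_lt (v x p : R) : 0 < v -> 0 < x -> 0 < p -> x < v * p -> / p < v / x.
Proof.
intros Hv Hx Hp H.
apply Rlt_div_r; trivial.
rewrite Rmult_comm; apply Rlt_div_l; trivial; lra.
Qed.

Lemma ratio_gt (v x p : R) : 0 < v -> 0 < x -> 0 < p -> v * p < x -> v / x < / p.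
Proof.
intros Hv Hx Hp H.
apply Rlt_div_l; trivial.
rewrite Rmult_comm; apply Rlt_div_r; trivial; lra.
Qed.

Lemma log_slope_ge (x : R) : 0 < x ->
  (1 - V x ^ 2 + (1 - V x ^ 2) ^ 2) / 2 <= log_slope x.
Proof.
intros Hx; apply le_log_slope; trivial.
(* [P q] is (1 + a) / q for the claimed bound a = (q + q^2) / 2. *)
pose (P := fun q => / q + (1 + q) / 2).
assert (HP : V x * P (1 - V x ^ 2) <= x).
{ revert x Hx.
  apply (Phi_V_le (fun v => v * P (1 - v ^ 2))
    (fun v => P (1 - v ^ 2) + 2 * v ^ 2 / (1 - v ^ 2) ^ 2 - v ^ 2)).
  - intros v Hv; assert (0 < 1 - v ^ 2) by nra.
    unfold P; auto_derive; [nra|]; field; nra.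
  - ring.
  - intros x Hx Hlt; pose proof (V_gt_0 x Hx); pose proof (V_lt_1 x).
    set (v := V x) in *.
    assert (Hq : 0 < 1 - v ^ 2 < 1) by nra.
    replace (v ^ 2) with (1 - (1 - v ^ 2)) by ring.
    set (q := 1 - v ^ 2) in *.
    assert (HPq : 0 < P q).
    { unfold P; assert (0 < / q) by (apply Rinv_0_lt_compat; lra); lra. }
    pose proof (ratio_lt v x (P q) ltac:(lra) Hx HPq Hlt).
    assert (HR : 0 < P q + 2 * (1 - q) / q ^ 2 - (1 - q)).
    { assert (0 <= 2 * (1 - q) / q ^ 2) by (apply Rdiv_le_0_compat; nra).
      unfold P in *; assert (1 < / q) by (rewrite <- Rinv_1; apply Rinv_lt_contravar; lra); lra. }
    (* Where the bound fails, [v / x] exceeds [/ P q]. Putting [/ P q] in its place leaves a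
       rational function of [q] that is 1 minus a positive term. *)
    apply Rlt_trans with ((P q + 2 * (1 - q) / q ^ 2 - (1 - q)) * (q - / P q)).
    + replace (1 - (1 - q)) with q by ring; apply Rmult_lt_compat_l; lra.
    + replace ((P q + 2 * (1 - q) / q ^ 2 - (1 - q)) * (q - / P q))
        with (1 - q ^ 2 * (1 - q) * (5 + 3 * q) / (2 * (2 + q + q ^ 2)))
        by (unfold P; field; repeat split; nra).
      assert (0 < q ^ 2 * (1 - q) * (5 + 3 * q) / (2 * (2 + q + q ^ 2))); [|lra].
      apply Rdiv_lt_0_compat; [|nra].
      repeat apply Rmult_lt_0_compat; lra. }
unfold P in HP; pose proof (V_gt_0 x Hx); pose proof (V_lt_1 x).
assert (0 < 1 - V x ^ 2) by nra.
etransitivity; [|exact HP]; right; field; lra.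
Qed.

(** The comparison function corresponds to the slope bound s = q. The result is kept as a bound on
    [x] because the proof of the quartic bound uses it to restrict [q]. *)
Lemma le_V_mul_inv_add_1 (x : R) : 0 < x -> x <= V x * (/ (1 - V x ^ 2) + 1).
Proof.
revert x.
apply (Phi_V_ge (fun v => v * (/ (1 - v ^ 2) + 1))
  (fun v => / (1 - v ^ 2) + 1 + 2 * v ^ 2 / (1 - v ^ 2) ^ 2)).
- intros v Hv; assert (0 < 1 - v ^ 2) by nra.
  auto_derive; [nra|]; field; nra.
- ring.
- intros x Hx Hlt; pose proof (V_gt_0 x Hx); pose proof (V_lt_1 x).
  set (v := V x) in *.
  assert (Hq : 0 < 1 - v ^ 2 < 1) by nra.
  replace (v ^ 2) with (1 - (1 - v ^ 2)) by ring.
  set (q := 1 - v ^ 2) in *.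
  replace (1 - (1 - q)) with q in * by ring.
  assert (0 < / q) by (apply Rinv_0_lt_compat; lra).
  pose proof (ratio_gt v x (/ q + 1) ltac:(lra) Hx ltac:(lra) Hlt).
  assert (0 <= 2 * (1 - q) / q ^ 2) by (apply Rdiv_le_0_compat; nra).
  apply Rlt_trans with ((/ q + 1 + 2 * (1 - q) / q ^ 2) * (q - / (/ q + 1))).
  + replace ((/ q + 1 + 2 * (1 - q) / q ^ 2) * (q - / (/ q + 1)))
      with (1 + (1 - q) ^ 2 / (1 + q)) by (field; repeat split; nra).
    assert (0 < (1 - q) ^ 2 / (1 + q)); [|lra].
    apply Rdiv_lt_0_compat; [apply pow_lt|]; lra.
  + apply Rmult_lt_compat_l; lra.
Qed.

Lemma log_slope_le_q (x : R) : 0 < x -> log_slope x <= 1 - V x ^ 2.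
Proof.
intros Hx; apply log_slope_le; trivial.
pose proof (V_gt_0 x Hx); pose proof (V_lt_1 x).
assert (0 < 1 - V x ^ 2) by nra.
etransitivity; [apply le_V_mul_inv_add_1, Hx|]; right; field; lra.
Qed.

(* The true expansion is s = q/2 + q^2/2 + 5/8 q^3 + ...; the larger coefficients make
   the quartic a supersolution wherever it lies below the bound [log_slope_le_q],
   which only happens for q < 3/10. *)
Lemma log_slope_le_quartic (x : R) : 0 < x -> let q := 1 - V x ^ 2 in
  log_slope x <= q / 2 + q ^ 2 / 2 + q ^ 3 + 10 * q ^ 4.
Proof.
intros Hx; apply log_slope_le; trivial.
pose (P := fun q => / q + / 2 + q / 2 + q ^ 2 + 10 * q ^ 3).
assert (HP : x <= V x * P (1 - V x ^ 2)).
{ revert x Hx.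
  apply (Phi_V_ge (fun v => v * P (1 - v ^ 2))
    (fun v => P (1 - v ^ 2) + 2 * v ^ 2 / (1 - v ^ 2) ^ 2
       - v ^ 2 * (1 + 4 * (1 - v ^ 2) + 60 * (1 - v ^ 2) ^ 2))).
  - intros v Hv; assert (0 < 1 - v ^ 2) by nra.
    unfold P; auto_derive; [nra|]; field; nra.
  - ring.
  - intros x Hx Hlt; pose proof (V_gt_0 x Hx); pose proof (V_lt_1 x).
    pose proof (le_V_mul_inv_add_1 x Hx) as Hle.
    set (v := V x) in *.
    assert (Hq : 0 < 1 - v ^ 2 < 1) by nra.
    replace (v ^ 2) with (1 - (1 - v ^ 2)) by ring.
    set (q := 1 - v ^ 2) in *.
    replace (1 - (1 - q)) with q by ring.
    assert (Hiq : 0 < / q) by (apply Rinv_0_lt_compat; lra).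
    (* At a failure point v P(q) < x <= v (1/q + 1), hence 1/2 + q/2 + q^2 + 10 q^3 < 1. *)
    assert (Hsmall : q < 3 / 10).
    { assert (P q < / q + 1) by (apply Rmult_lt_reg_l with v; lra).
      unfold P in *; nra. }
    assert (HPq : 0 < P q) by (unfold P; nra).
    pose proof (ratio_gt v x (P q) ltac:(lra) Hx HPq Hlt).
    set (a := P q + 2 * (1 - q) / q ^ 2 - (1 - q) * (1 + 4 * q + 60 * q ^ 2)).
    assert (Ha : 0 < a).
    { assert (Hi3 : 10 / 3 < / q) by (apply (Rmult_lt_reg_l q); [lra|]; rewrite Rinv_r; lra).
      assert (2 * (1 - q) / q ^ 2 = 2 * (1 - q) * / q * / q) by (field; lra).
      assert (100 / 9 < / q * / q) by nra.
      unfold a, P; nra. }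
    apply Rlt_trans with (a * (q - / P q)).
    + set (b := 1 + q / 2 + q ^ 2 / 2 + q ^ 3 + 10 * q ^ 4).
      assert (0 < b) by (unfold b; nra).
      replace (a * (q - / P q))
        with (1 + q ^ 2 * (3 / 4 + 33 / 2 * q - 197 / 4 * q ^ 2
                          - 45 * q ^ 4 - 480 * q ^ 5 + 700 * q ^ 6) / b).
      2:{ unfold a, P, b in *; field; repeat split; nra. }
      assert (0 < q ^ 2 * (3 / 4 + 33 / 2 * q - 197 / 4 * q ^ 2
                          - 45 * q ^ 4 - 480 * q ^ 5 + 700 * q ^ 6) / b); [|lra].
      apply Rdiv_lt_0_compat; trivial.
      apply Rmult_lt_0_compat; [apply pow_lt; lra|].
      assert (q ^ 4 <= (3 / 10) ^ 4) by (apply pow_incr; lra).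
      assert (0 <= q ^ 4) by (apply pow_le; lra).
      assert (q ^ 4 * (45 + 480 * q - 700 * q ^ 2)
              <= (3 / 10) ^ 4 * (45 + 480 * (3 / 10) - 700 * (3 / 10) ^ 2)) by nra.
      nra.
    + apply Rmult_lt_compat_l; lra. }
unfold P in HP; pose proof (V_gt_0 x Hx); pose proof (V_lt_1 x).
assert (0 < 1 - V x ^ 2) by nra.
etransitivity; [exact HP|]; right; field; lra.
Qed.

(* The sign of this polynomial decides the convexity of K as a function of r
   (see [is_derive_sensitivity]). For small q it is of order q^4, because its terms of
   order q^2 and q^3 cancel on s = q/2 + q^2/2, so s is needed up to an error of order
   q^3. *)
Lemma convexity_poly_gt0_small (q s : R) : 0 < q < 3 / 10 ->
  (q + q ^ 2) / 2 <= s -> s <= q / 2 + q ^ 2 / 2 + q ^ 3 + 10 * q ^ 4 ->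
  0 < 2 * q ^ 2 * s ^ 4 + (8 - 12 * q) * s ^ 3 + (8 - 8 * q + 5 * q ^ 2) * s ^ 2
      - (10 * q - 4 * q ^ 2) * s + 3 * q ^ 2.
Proof.
intros Hq Hlo Hhi.
(* [c] measures the excess of [s] over its lower bound in units of q^3. In terms of [c] the
   polynomial has the factor q^4. *)
set (c := (s - (q + q ^ 2) / 2) / q ^ 3).
assert (Hq3 : 0 < q ^ 3) by (apply pow_lt; lra).
assert (Hc0 : 0 <= c) by (apply Rdiv_le_0_compat; lra).
assert (Hc1 : c <= 1 + 10 * q) by (apply Rle_div_l; lra).
replace s with ((q + q ^ 2) / 2 + q ^ 3 * c) by (unfold c; field; lra).
clearbody c; clear s Hlo Hhi.
set (c0 := 11 / 4 - q - 17 / 8 * q ^ 2 - q ^ 3 + 3 / 4 * q ^ 4 + q ^ 5 / 2 + q ^ 6 / 8).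
set (c1 := - 2 + 10 * q - 7 * q ^ 3 - 8 * q ^ 4 + 3 * q ^ 5 + 3 * q ^ 6 + q ^ 7).
set (c2 := 8 + 4 * q - q ^ 2 - 18 * q ^ 3 + 3 * q ^ 4 + 6 * q ^ 5 + 3 * q ^ 6).
set (c3 := 8 - 12 * q + 4 * q ^ 3 + 4 * q ^ 4).
match goal with |- 0 < ?t => replace t with
  (q ^ 4 * (c0 + c1 * c + q ^ 2 * c2 * c ^ 2 + q ^ 5 * c3 * c ^ 3 + 2 * q ^ 10 * c ^ 4))
  by (unfold c0, c1, c2, c3; field) end.
apply Rmult_lt_0_compat; [apply pow_lt; lra|].
assert (Hp : forall n, 0 < q ^ n) by (intros n; apply pow_lt; lra).
pose proof (Hp 2%nat); pose proof (Hp 4%nat); pose proof (Hp 5%nat);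
pose proof (Hp 6%nat); pose proof (Hp 7%nat).
assert (Q2 : q ^ 2 < 9 / 100) by nra.
assert (Q3 : q ^ 3 < 27 / 1000) by nra.
assert (Q4 : q ^ 4 < 81 / 10000) by nra.
assert (0 < c0) by (unfold c0; lra).
assert (0 < c2) by (unfold c2; lra).
assert (0 < c3) by (unfold c3; lra).
assert (0 < c0 + c1 * c).
(* The expression is affine in [c], so for negative [c1] its minimum is at the largest value c = 1 +
   10 q. *)
{ destruct (Rle_or_lt 0 c1); [nra|].
  assert (0 < c0 + c1 * (1 + 10 * q)); [|nra].
  replace (c0 + c1 * (1 + 10 * q)) with
    (3 / 4 - 11 * q + 783 / 8 * q ^ 2 - 8 * q ^ 3 - 309 / 4 * q ^ 4 - 153 / 2 * q ^ 5
     + 265 / 8 * q ^ 6 + 31 * q ^ 7 + 10 * q ^ 8) by (unfold c0, c1; field).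
  pose proof (Hp 8%nat).
  (* The negative higher powers are absorbed into the q^2 term; the remaining quadratic has negative
     discriminant. *)
  assert (q ^ 3 < 3 / 10 * q ^ 2) by nra.
  assert (q ^ 4 < 9 / 100 * q ^ 2) by nra.
  assert (q ^ 5 < 27 / 1000 * q ^ 2) by nra.
  nra. }
assert (0 <= q ^ 2 * c2 * c ^ 2) by (repeat apply Rmult_le_pos; try apply pow2_ge_0; lra).
assert (0 <= q ^ 5 * c3 * c ^ 3) by (repeat apply Rmult_le_pos; try apply pow_le; lra).
assert (0 <= 2 * q ^ 10 * c ^ 4) by (repeat apply Rmult_le_pos; try apply pow_le; lra).
lra.
Qed.

(** Away from q = 0 the bound s <= q suffices. The polynomial vanishes at q = s = 1, which accounts
    for the factor 1 - q split off below. *)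
Lemma convexity_poly_gt0_large (q s : R) : 3 / 10 <= q < 1 ->
  (q + q ^ 2) / 2 <= s -> s <= q ->
  0 < 2 * q ^ 2 * s ^ 4 + (8 - 12 * q) * s ^ 3 + (8 - 8 * q + 5 * q ^ 2) * s ^ 2
      - (10 * q - 4 * q ^ 2) * s + 3 * q ^ 2.
Proof.
intros Hq Hlo Hhi.
(* [w] in [0, 1] is the relative position of [s] between its two bounds, whose distance is q (1 - q)
   / 2. *)
set (w := (s - (q + q ^ 2) / 2) / (q * (1 - q) / 2)).
assert (Hqq : 0 < q * (1 - q) / 2) by nra.
assert (Hw0 : 0 <= w) by (apply Rdiv_le_0_compat; nra).
assert (Hw1 : w <= 1) by (apply Rle_div_l; lra).
replace s with ((q + q ^ 2) / 2 + q * (1 - q) / 2 * w) by (unfold w; field; lra).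
clearbody w; clear s Hlo Hhi.
set (a0 := 11 / 4 + 7 / 4 * q - 3 / 8 * q ^ 2 - 11 / 8 * q ^ 3 - 5 / 8 * q ^ 4 - q ^ 5 / 8).
set (a1 := - 1 + 4 * q + 4 * q ^ 2 + q ^ 3 / 2 - 7 / 2 * q ^ 4 - 2 * q ^ 5 - q ^ 6 / 2).
set (a2 := 2 + q - q ^ 2 / 4 - 9 / 2 * q ^ 3 + 3 / 4 * q ^ 4 + 3 / 2 * q ^ 5 + 3 / 4 * q ^ 6).
set (a3 := 1 - 3 / 2 * q + q ^ 3 / 2 + q ^ 4 / 2).
match goal with |- 0 < ?t => replace t with
  (q ^ 2 * (1 - q) * (q ^ 2 * a0 + (1 - q) * a1 * w + (1 - q) * a2 * w ^ 2
     + q * (1 - q) ^ 2 * a3 * w ^ 3 + q ^ 4 * (1 - q) ^ 3 / 8 * w ^ 4))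
  by (unfold a0, a1, a2, a3; field) end.
assert (Hp : forall n, 0 < q ^ n) by (intros n; apply pow_lt; lra).
assert (Hle : forall n, q ^ S n <= q ^ n) by (intros n; specialize (Hp n); simpl; nra).
pose proof (Hle 1%nat) as L1; rewrite pow_1 in L1.
pose proof (Hle 2%nat); pose proof (Hle 3%nat); pose proof (Hle 4%nat); pose proof (Hle 5%nat).
assert (0 < a0) by (unfold a0; lra).
(* This is where [q] must stay away from 0: the constant term of [a1] is -1. *)
assert (0 <= a1).
{ unfold a1; nra. }
assert (0 <= a2).
{ unfold a2; nra. }
assert (0 <= a3).
{ unfold a3; nra. }
apply Rmult_lt_0_compat; [apply Rmult_lt_0_compat; [apply Hp|lra]|].
assert (0 < q ^ 2 * a0) by (apply Rmult_lt_0_compat; [apply Hp|lra]).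
assert (0 <= (1 - q) * a1 * w) by (repeat apply Rmult_le_pos; lra).
assert (0 <= (1 - q) * a2 * w ^ 2)
  by (repeat apply Rmult_le_pos; try apply pow_le; lra).
assert (0 <= q * (1 - q) ^ 2 * a3 * w ^ 3)
  by (repeat apply Rmult_le_pos; try apply pow_le; lra).
assert (0 <= q ^ 4 * (1 - q) ^ 3 / 8 * w ^ 4)
  by (repeat apply Rmult_le_pos; try apply pow_le; lra).
lra.
Qed.

(** * The curve K = coupling x, r = V x *)

Lemma convexity_poly_gt0 (q s : R) : 0 < q < 1 ->
  (q + q ^ 2) / 2 <= s -> s <= q -> s <= q / 2 + q ^ 2 / 2 + q ^ 3 + 10 * q ^ 4 ->
  0 < 2 * q ^ 2 * s ^ 4 + (8 - 12 * q) * s ^ 3 + (8 - 8 * q + 5 * q ^ 2) * s ^ 2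
      - (10 * q - 4 * q ^ 2) * s + 3 * q ^ 2.
Proof.
intros Hq Hlo Hhi Hhi4; destruct (Rlt_or_le q (3 / 10)).
- apply convexity_poly_gt0_small; lra.
- apply convexity_poly_gt0_large; lra.
Qed.

Definition coupling (x : R) : R :=
  (1 + log_slope x) ^ 2 / (2 * (1 - V x ^ 2) * log_slope x).

Definition monotonicity_factor (x : R) : R :=
  2 * log_slope x - (1 - V x ^ 2) * (1 + log_slope x ^ 2).

Definition dcoupling (x : R) : R :=
  (1 + log_slope x) ^ 2 * monotonicity_factor x /
  (2 * (1 - V x ^ 2) ^ 2 * log_slope x ^ 2 * x).

(* [V' / coupling'], that is, dr/dK along the curve [K = coupling x, r = V x]. *)
Definition sensitivity (x : R) : R :=
  2 * V x * (1 - V x ^ 2) ^ 2 * log_slope x ^ 3 /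
  ((1 + log_slope x) ^ 2 * monotonicity_factor x).

Lemma slope_bounds (x : R) : 0 < x ->
  0 < V x < 1 /\ 0 < 1 - V x ^ 2 < 1 /\ 0 < log_slope x < 1.
Proof.
intros Hx; pose proof (V_gt_0 x Hx); pose proof (V_lt_1 x).
pose proof (log_slope_ge x Hx); pose proof (log_slope_le_q x Hx).
assert (0 < 1 - V x ^ 2 < 1) by nra.
repeat split; try lra; nra.
Qed.

(** The factor 2 s - q (1 + s^2) increases with [s] in the relevant range, so it suffices to insert
    the lower bound [l] of [s]. *)
Lemma monotonicity_factor_gt0 (x : R) : 0 < x -> 0 < monotonicity_factor x.
Proof.
intros Hx; destruct (slope_bounds x Hx) as [Hv [Hq Hs]].
pose proof (log_slope_ge x Hx).
unfold monotonicity_factor.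
set (q := 1 - V x ^ 2) in *; set (s := log_slope x) in *.
clearbody q s.
set (l := (q + q ^ 2) / 2) in *.
assert (0 < 2 * l - q * (1 + l ^ 2)).
{ replace (2 * l - q * (1 + l ^ 2)) with (q ^ 2 * (1 - q * (1 + q) ^ 2 / 4))
    by (unfold l; field).
  apply Rmult_lt_0_compat; [apply pow_lt; lra|nra]. }
assert (l < 1) by (unfold l; nra).
assert (0 <= (s - l) * (2 - q * (s + l))); [|lra].
apply Rmult_le_pos; nra.
Qed.

Lemma is_derive_V_log_slope (x : R) : 0 < x ->
  is_derive V x (V x * log_slope x / x).
Proof.
intros Hx; destruct (slope_bounds x Hx) as [Hv _].
evar_last; [apply is_derive_V; lra|].
unfold log_slope; simpl; field; lra.
Qed.

Lemma is_derive_log_slope (x : R) : 0 < x ->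
  let q := 1 - V x ^ 2 in let s := log_slope x in
  is_derive log_slope x ((1 + s) * (q * (1 + s) - 2 * s) / (q * x)).
Proof.
intros Hx q s; destruct (slope_bounds x Hx) as [Hv [Hq Hs]].
pose proof (is_derive_V_log_slope x Hx) as D.
unfold log_slope at 1; auto_derive.
- repeat split; try (eexists; eassumption); lra.
- rewrite (is_derive_unique (fun y : R => V y) x _ D).
  unfold s, q, log_slope; field; lra.
Qed.

Lemma is_derive_coupling (x : R) : 0 < x -> is_derive coupling x (dcoupling x).
Proof.
intros Hx; destruct (slope_bounds x Hx) as [Hv [Hq Hs]].
pose proof (is_derive_V_log_slope x Hx) as DV.
pose proof (is_derive_log_slope x Hx) as DS; simpl in DS.
unfold coupling; auto_derive.
- repeat split; try (eexists; eassumption).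
  apply Rgt_not_eq; repeat apply Rmult_lt_0_compat; lra.
- rewrite (is_derive_unique (fun y : R => V y) x _ DV).
  rewrite (is_derive_unique (fun y : R => log_slope y) x _ DS).
  unfold dcoupling, monotonicity_factor; field; nra.
Qed.

Lemma dcoupling_gt0 (x : R) : 0 < x -> 0 < dcoupling x.
Proof.
intros Hx; destruct (slope_bounds x Hx) as [Hv [Hq Hs]].
pose proof (monotonicity_factor_gt0 x Hx).
unfold dcoupling; positivity.
Qed.

(** Since K increases with [x], the sign of this derivative is that of d^2r/dK^2. *)
Lemma is_derive_sensitivity (x : R) : 0 < x ->
  let q := 1 - V x ^ 2 in let s := log_slope x in
  is_derive sensitivity x
   (- (sensitivity x / (q * s * monotonicity_factor x * x) *
      (2 * q ^ 2 * s ^ 4 + (8 - 12 * q) * s ^ 3 + (8 - 8 * q + 5 * q ^ 2) * s ^ 2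
      - (10 * q - 4 * q ^ 2) * s + 3 * q ^ 2))).
Proof.
intros Hx q s; destruct (slope_bounds x Hx) as [Hv [Hq Hs]].
pose proof (is_derive_V_log_slope x Hx) as DV.
pose proof (is_derive_log_slope x Hx) as DS; simpl in DS.
pose proof (monotonicity_factor_gt0 x Hx) as HN.
unfold sensitivity, monotonicity_factor in *; auto_derive.
- repeat split; try (eexists; eassumption).
  apply Rgt_not_eq; repeat apply Rmult_lt_0_compat; simpl in *; lra.
- rewrite (is_derive_unique (fun y : R => V y) x _ DV).
  rewrite (is_derive_unique (fun y : R => log_slope y) x _ DS).
  unfold q, s; field; simpl in *; repeat split; lra.
Qed.

(** * Bijectivity of [coupling] and the solutions of the defining equation *)

Lemma coupling_lt (x y : R) : 0 < x -> x < y -> coupling x < coupling y.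
Proof.
intros Hx Hxy.
destruct (MVT_gen coupling x y dcoupling) as [c [Hc E]].
- rewrite Rmin_left, Rmax_right by lra; intros z Hz; apply is_derive_coupling; lra.
- rewrite Rmin_left, Rmax_right by lra; intros z Hz.
  apply continuity_pt_filterlim, (ex_derive_continuous coupling).
  eexists; apply is_derive_coupling; lra.
- rewrite Rmin_left, Rmax_right in Hc by lra.
  pose proof (dcoupling_gt0 c ltac:(lra)); nra.
Qed.

Lemma coupling_inj (x y : R) : 0 < x -> 0 < y -> coupling x = coupling y -> x = y.
Proof.
intros Hx Hy E; destruct (Rtotal_order x y) as [H|[H|H]]; trivial;
  apply coupling_lt in H; lra.
Qed.

(** For K = [coupling x] the radicand is the perfect square (K - (1 + s)/q)^2. As s < 1, its base is
    positive, so the root gives f = (1 + s)/q and f r = x. *)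
Lemma sync_level_coupling (x : R) : 0 < x -> sync_level (coupling x) (V x).
Proof.
intros Hx; destruct (slope_bounds x Hx) as [Hv [Hq Hs]].
pose proof (V_mul_log_slope x Hx) as E.
split; [lra|].
set (q := 1 - V x ^ 2) in *; set (s := log_slope x) in *.
assert (Hgap : coupling x - (1 + s) / q = (1 + s) * (1 - s) / (2 * q * s))
  by (unfold coupling; fold s q; field; lra).
split.
- assert (0 < coupling x - 2 / q); [|lra].
  replace (coupling x - 2 / q) with ((1 - s) ^ 2 / (2 * q * s))
    by (unfold coupling; fold s q; field; lra).
  apply Rdiv_lt_0_compat; [apply pow_lt; lra|nra].
- unfold Defs.f; fold q.
  replace (coupling x ^ 2 - 2 * coupling x / q) with ((coupling x - (1 + s) / q) ^ 2)
    by (unfold coupling; fold s q; field; lra).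
  rewrite sqrt_pow2.
  + replace ((coupling x - (coupling x - (1 + s) / q)) * V x) with x; trivial.
    replace x with (V x * (1 + s) / q) at 1 by (rewrite E; field; lra).
    field; lra.
  + rewrite Hgap; apply Rdiv_le_0_compat; nra.
Qed.

Lemma sync_level_inv (K r : R) : sync_level K r ->
  0 < Defs.f r K * r /\ V (Defs.f r K * r) = r /\ coupling (Defs.f r K * r) = K.
Proof.
intros [Hr [HK E]].
assert (Hq : 0 < 1 - r ^ 2 < 1) by nra.
set (q := 1 - r ^ 2) in *.
assert (HqK : 2 < K * q) by (apply Rlt_div_l in HK; lra).
assert (HK0 : 0 < K) by nra.
assert (Hdisc : K ^ 2 - 2 * K / q = K * (K * q - 2) / q) by (field; lra).
assert (Hdisc0 : 0 < K ^ 2 - 2 * K / q).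
{ rewrite Hdisc; apply Rdiv_lt_0_compat; nra. }
pose proof (sqrt_lt_R0 _ Hdisc0) as Hs.
pose proof (pow2_sqrt _ (Rlt_le _ _ Hdisc0)) as Hs2.
assert (Hf : 0 < Defs.f r K).
{ unfold Defs.f; fold q.
  assert (0 < 2 * K / q) by (apply Rdiv_lt_0_compat; lra).
  set (t := sqrt _) in *; nra. }
assert (Hx : 0 < Defs.f r K * r) by (apply Rmult_lt_0_compat; lra).
repeat split; trivial.
destruct (slope_bounds _ Hx) as [_ [_ Hsl]].
unfold coupling; rewrite E; fold q.
assert (Hslope : log_slope (Defs.f r K * r) = Defs.f r K * q - 1).
{ unfold log_slope; rewrite E; unfold q; field; lra. }
rewrite Hslope in *.
(* [f r K] is the smaller root of q t^2 - 2 K q t + 2 K = 0; with q f = 1 + s this equation, solved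
   for K, is the formula of [coupling]. *)
assert (Hquad : Defs.f r K ^ 2 * q = 2 * K * (Defs.f r K * q - 1)).
{ unfold Defs.f in *; fold q in Hs2 |- *; set (t := sqrt _) in *.
  transitivity (K ^ 2 * q - 2 * K * t * q + t ^ 2 * q); [ring|].
  rewrite Hs2; field; lra. }
replace ((1 + (Defs.f r K * q - 1)) ^ 2) with (Defs.f r K ^ 2 * q * q) by ring.
rewrite Hquad; field; lra.
Qed.

Lemma sync_level_unique (K r r' : R) : sync_level K r -> sync_level K r' -> r = r'.
Proof.
intros H H'.
destruct (sync_level_inv _ _ H) as [Hx [E C]].
destruct (sync_level_inv _ _ H') as [Hx' [E' C']].
rewrite <- E, <- E'; f_equal; apply coupling_inj; trivial; lra.
Qed.

(** The numerator is (1 + s)^2 - 4 q s, written as a sum of terms that are visibly positive and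
    small for small [x]. *)
Lemma coupling_sub_2 (x : R) : 0 < x ->
  coupling x - 2 = ((1 - log_slope x) ^ 2 + 4 * V x ^ 2 * log_slope x) /
                   (2 * (1 - V x ^ 2) * log_slope x).
Proof.
intros Hx; destruct (slope_bounds x Hx) as [Hv [Hq Hs]].
unfold coupling; field; lra.
Qed.

(** This follows from V (1 + s) = x q, because 1 + (q + q^2)/2 - 2 q = (1 - q)(2 - q)/2 is
    positive. *)
Lemma V_le_half (x : R) : 0 < x -> V x <= x / 2.
Proof.
intros Hx; destruct (slope_bounds x Hx) as [Hv [Hq Hs]].
pose proof (log_slope_ge x Hx).
pose proof (V_mul_log_slope x Hx) as E.
set (q := 1 - V x ^ 2) in *; set (s := log_slope x) in *; clearbody s q.
assert (V x * (2 * q) <= V x * (1 + s)) by (apply Rmult_le_compat_l; nra).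
apply (Rmult_le_reg_r (2 * q)); lra.
Qed.

Lemma one_sub_V_sqr_le (x : R) : 0 < x -> 1 - V x ^ 2 <= 2 / x.
Proof.
intros Hx; destruct (slope_bounds x Hx) as [Hv [Hq Hs]].
pose proof (V_mul_log_slope x Hx) as E.
apply Rle_div_r; trivial; nra.
Qed.

Lemma coupling_surj (K : R) : 2 < K -> exists x, 0 < x /\ coupling x = K.
Proof.
intros HK.
(* Near 0, [coupling a - 2] is controlled by V(a)^2 <= a/4; the factor 1/8 leaves room for the
   constants. *)
set (a := Rmin 1 ((K - 2) / 8)).
assert (Ha : 0 < a) by (apply Rmin_glb_lt; lra).
assert (Ha1 : a <= 1) by apply Rmin_l.
assert (Ha2 : a <= (K - 2) / 8) by apply Rmin_r.
(* With this choice 1 - V(b)^2 <= 2/b = 1/(K + 2). *)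
set (b := 2 * K + 4).
assert (Hlow : coupling a < K).
{ destruct (slope_bounds a Ha) as [Hv [Hq Hs]].
  pose proof (V_le_half a Ha).
  pose proof (log_slope_ge a Ha).
  assert (coupling a - 2 < K - 2); [|lra].
  rewrite coupling_sub_2 by trivial.
  assert (Hu : V a ^ 2 <= a / 4) by nra.
  set (u := V a ^ 2) in *; set (s := log_slope a) in *; clearbody u s.
  assert (1 - s <= 3 / 2 * u) by nra.
  apply Rlt_div_l; [nra|].
  assert (HA : (1 - s) ^ 2 <= 9 / 4 * u ^ 2) by nra.
  assert (HB : 9 / 16 <= (1 - u) * s * 8 / 5 * 2) by nra.
  assert (0 <= u) by lra.
  nra. }
assert (Hhigh : K < coupling b).
{ assert (Hb : 0 < b) by (unfold b; lra).
  destruct (slope_bounds b Hb) as [Hv [Hq Hs]].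
  pose proof (one_sub_V_sqr_le b Hb) as Hqb.
  assert (K - 2 < coupling b - 2); [|lra].
  rewrite coupling_sub_2 by trivial.
  apply Rle_div_r in Hqb; trivial.
  set (q := 1 - V b ^ 2) in *.
  replace (V b ^ 2) with (1 - q) by (unfold q; ring).
  set (s := log_slope b) in *; clearbody s q.
  apply Rlt_div_r; [nra|].
  unfold b in *.
  assert (q * K <= 1 - 2 * q) by lra.
  assert ((K - 2) * (2 * q * s) <= (1 - 2 * q) * (2 * s) - 4 * q * s) by nra.
  nra. }
assert (Hab : a < b) by (unfold b; lra).
destruct (IVT_interv (fun x => coupling x - K) a b) as [x [Hx E]]; try lra.
- intros x Hx.
  apply continuity_pt_filterlim, (ex_derive_continuous (fun x => coupling x - K)).
  exists (minus (dcoupling x) 0).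
  apply (is_derive_minus (V := R_NormedModule) coupling (fun _ => K)).
  + apply is_derive_coupling; lra.
  + apply (is_derive_const (V := R_NormedModule)).
- exists x; lra.
Qed.

(** Monotonicity of [g] brackets [h z] near [h y], so [h] is continuous; its difference quotients
    are then reciprocals of those of [g]. *)
Lemma is_derive_inverse (g g' h : R -> R) (a y : R) :
  (forall x, 0 < x -> is_derive g x (g' x)) -> (forall x, 0 < x -> 0 < g' x) ->
  (forall u v, 0 < u -> u < v -> g u < g v) ->
  (forall z, a < z -> 0 < h z /\ g (h z) = z) -> a < y ->
  is_derive h y (/ g' (h y)).
Proof.
intros Hg Hg' Hincr Hh Hy.
destruct (Hh y Hy) as [Hhy Ey].
assert (Hle : forall u v, 0 < u -> 0 < v -> g u < g v -> u < v).
{ intros u v Hu Hv H; destruct (Rlt_or_le u v) as [|[Hvu| ->]]; trivial; [|lra].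
  apply Hincr in Hvu; lra. }
assert (Hcont : filterlim h (locally y) (locally (h y))).
{ apply filterlim_locally; intros eps.
  (* Halving keeps [h y - e] positive, where [g] is known to be increasing. *)
  set (e := Rmin eps (h y) / 2).
  pose proof (cond_pos eps).
  assert (He : 0 < Rmin eps (h y)) by (apply Rmin_glb_lt; lra).
  pose proof (Rmin_l eps (h y)); pose proof (Rmin_r eps (h y)).
  assert (Hlo : g (h y - e) < y) by (rewrite <- Ey at 2; apply Hincr; unfold e; lra).
  assert (Hhi : y < g (h y + e)) by (rewrite <- Ey at 1; apply Hincr; unfold e; lra).
  assert (L : locally y (fun z => Rmax a (g (h y - e)) < z /\ z < g (h y + e))).
  { apply filter_and.
    - apply open_gt; apply Rmax_lub_lt; trivial.
    - apply open_lt; trivial. }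
  revert L; apply filter_imp; intros z [Hz1 Hz2].
  pose proof (Rmax_l a (g (h y - e))); pose proof (Rmax_r a (g (h y - e))).
  destruct (Hh z ltac:(lra)) as [Hhz Ez].
  assert (h y - e < h z) by (apply Hle; unfold e in *; lra).
  assert (h z < h y + e) by (apply Hle; unfold e in *; lra).
  apply Rabs_def1; unfold minus, plus, opp; simpl; unfold e in *; lra. }
pose proof (Hg (h y) Hhy) as D; apply is_derive_Reals in D.
pose proof (Hg' (h y) Hhy) as Hpos.
apply is_derive_Reals; intros eps Heps.
assert (Cinv : filterlim Rinv (locally (g' (h y))) (locally (/ g' (h y)))).
{ apply (ex_derive_continuous Rinv); auto_derive; lra. }
destruct (proj1 (filterlim_locally _ _) Cinv (mkposreal eps Heps)) as [d1 H1].
destruct (D d1 (cond_pos d1)) as [d2 H2].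
destruct (proj1 (filterlim_locally _ _) Hcont d2) as [d3 H3].
assert (Hd : 0 < Rmin d3 (y - a)) by (apply Rmin_glb_lt; [apply cond_pos|lra]).
exists (mkposreal _ Hd); intros k Hk Hkd; simpl in Hkd.
pose proof (Rmin_l d3 (y - a)); pose proof (Rmin_r d3 (y - a)).
assert (Hball : ball y d3 (y + k)).
{ unfold ball; simpl; unfold AbsRing_ball, abs, minus, plus, opp; simpl.
  replace (y + k + - y) with k by ring; lra. }
apply H3 in Hball.
apply Rabs_def2 in Hkd.
destruct (Hh (y + k) ltac:(lra)) as [Hhk Ek].
assert (Hne : h (y + k) - h y <> 0).
{ intros E; replace (h (y + k)) with (h y) in Ek by lra; lra. }
specialize (H2 (h (y + k) - h y) Hne Hball).
apply H1 in H2.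
replace (h y + (h (y + k) - h y)) with (h (y + k)) in H2 by ring.
rewrite Ek, Ey in H2.
replace ((h (y + k) - h y) / k) with (/ ((y + k - y) / (h (y + k) - h y)))
  by (field; split; trivial; lra).
exact H2.
Qed.

(** * Asymptotics and derivatives of the branch *)

Lemma coupling_gt_2 (x : R) : 0 < x -> 2 < coupling x.
Proof.
intros Hx; destruct (slope_bounds x Hx) as [Hv [Hq Hs]].
pose proof (coupling_sub_2 x Hx).
assert (0 < coupling x - 2); [|lra].
rewrite coupling_sub_2 by trivial.
apply Rdiv_lt_0_compat; nra.
Qed.

Lemma V_sqr_le_coupling (x : R) : 0 < x -> V x ^ 2 <= (coupling x - 2) / 2.
Proof.
intros Hx; destruct (slope_bounds x Hx) as [Hv [Hq Hs]].
rewrite coupling_sub_2 by trivial.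
set (u := V x ^ 2) in *; set (s := log_slope x) in *; clearbody u s.
assert (u * 2 <= ((1 - s) ^ 2 + 4 * u * s) / (2 * (1 - u) * s)); [|lra].
apply -> Rle_div_r; [|nra].
assert (0 <= u ^ 2 * s) by (apply Rmult_le_pos; nra).
pose proof (pow2_ge_0 (1 - s)).
nra.
Qed.

Lemma V_sqr_ge_coupling (x : R) : 0 < x -> coupling x <= 3 ->
  (coupling x - 2) / 2 * (1 - 2 * (coupling x - 2)) <= V x ^ 2.
Proof.
intros Hx HK; destruct (slope_bounds x Hx) as [Hv [Hq Hs]].
pose proof (V_sqr_le_coupling x Hx) as Hu.
pose proof (log_slope_ge x Hx) as Hlo.
pose proof (coupling_sub_2 x Hx) as E.
set (e := coupling x - 2) in *.
assert (He : 0 < e <= 1) by (unfold e; pose proof (coupling_gt_2 x Hx); lra).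
set (u := V x ^ 2) in *; set (s := log_slope x) in *; clearbody u s e.
assert (H1 : 0 <= 1 - s <= 3 / 2 * u) by nra.
assert (E' : e * (2 * (1 - u) * s) = (1 - s) ^ 2 + 4 * u * s).
{ rewrite E; field; lra. }
assert (Hs4 : (1 - u) ^ 2 <= s) by nra.
(* Since u <= 1/2 forces s >= 1/4, the square is bounded by a multiple of [s], and [s] can be
   cancelled from [E']. *)
assert (H2 : (1 - s) ^ 2 <= 9 * u ^ 2 * s).
{ assert ((1 - s) ^ 2 <= 9 / 4 * u ^ 2) by nra.
  assert (1 / 4 <= s) by nra.
  assert (9 / 4 * u ^ 2 <= 9 * u ^ 2 * s) by nra.
  lra. }
assert (e * (2 * (1 - u)) <= 9 * u ^ 2 + 4 * u).
{ apply (Rmult_le_reg_r s); lra. }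
nra.
Qed.

(** Here q^2 K = q (1 + s)^2 / (2 s), which is at most (1 + s)^2 <= 4 because q <= 2 s. *)
Lemma one_sub_V_sqr_le_sqrt_coupling (x : R) : 0 < x ->
  1 - V x ^ 2 <= 2 / sqrt (coupling x).
Proof.
intros Hx; destruct (slope_bounds x Hx) as [Hv [Hq Hs]].
pose proof (log_slope_ge x Hx) as Hlo.
pose proof (coupling_gt_2 x Hx) as HK.
assert (Hr : 0 < sqrt (coupling x)) by (apply sqrt_lt_R0; lra).
apply Rle_div_r; trivial.
apply Rsqr_incr_0_var; [|lra].
unfold Rsqr.
replace ((1 - V x ^ 2) * sqrt (coupling x) * ((1 - V x ^ 2) * sqrt (coupling x)))
  with ((1 - V x ^ 2) ^ 2 * (sqrt (coupling x) * sqrt (coupling x))) by ring.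
rewrite sqrt_sqrt by lra.
unfold coupling.
set (q := 1 - V x ^ 2) in *; set (s := log_slope x) in *; clearbody q s.
replace (q ^ 2 * ((1 + s) ^ 2 / (2 * q * s))) with (q * (1 + s) ^ 2 / (2 * s))
  by (field; lra).
apply Rle_div_l; nra.
Qed.

(* [4 (1 - r)^2 K = 2 q (1 + s)^2 / ((1 + r)^2 s)] with [q / 2 <= s <= q / 2 + 12 q^2]. *)
Lemma coupling_asymp (x : R) : 0 < x -> let q := 1 - V x ^ 2 in
  1 - 24 * q <= ((1 - V x) * (2 * sqrt (coupling x))) ^ 2 <= (1 + 3 * q) ^ 2.
Proof.
intros Hx q; destruct (slope_bounds x Hx) as [Hv [Hq Hs]].
pose proof (log_slope_ge x Hx) as Hlo.
pose proof (log_slope_le_q x Hx) as Hhi.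
pose proof (log_slope_le_quartic x Hx) as Hhi4; cbv zeta in Hhi4.
pose proof (coupling_gt_2 x Hx) as HK.
fold q in Hlo, Hhi, Hhi4, Hq.
replace (((1 - V x) * (2 * sqrt (coupling x))) ^ 2)
  with (4 * (1 - V x) ^ 2 * (sqrt (coupling x) * sqrt (coupling x))) by ring.
rewrite sqrt_sqrt by lra.
unfold coupling; fold q.
set (v := V x) in *; set (s := log_slope x) in *.
replace (4 * (1 - v) ^ 2 * ((1 + s) ^ 2 / (2 * q * s)))
  with (2 * q * (1 + s) ^ 2 / ((1 + v) ^ 2 * s))
  by (unfold q in *; field; repeat split; nra).
assert (Hv1 : 1 - q <= v) by (unfold q; nra).
assert (Hs12 : s <= q / 2 + 12 * q ^ 2).
{ assert (q ^ 3 <= q ^ 2) by nra.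
  assert (q ^ 4 <= q ^ 2) by nra.
  lra. }
clearbody s; assert (Hden : 0 < (1 + v) ^ 2 * s) by (apply Rmult_lt_0_compat; nra).
split.
- apply Rle_div_r; trivial.
  (* The constant 24 comes from 4 (q/2 + 12 q^2) = 2 q (1 + 24 q), whose product with 1 - 24 q is at
     most 2 q. *)
  destruct (Rle_or_lt (1 - 24 * q) 0); [nra|].
  assert ((1 + v) ^ 2 * s <= 4 * (q / 2 + 12 * q ^ 2)) by (apply Rmult_le_compat; nra).
  assert ((1 - 24 * q) * ((1 + v) ^ 2 * s) <= (1 - 24 * q) * (4 * (q / 2 + 12 * q ^ 2)))
    by (apply Rmult_le_compat_l; lra).
  nra.
- apply Rle_div_l; trivial.
  assert (H1 : (1 + s) ^ 2 <= (1 + q) ^ 2) by (apply pow_incr; lra).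
  (* By v >= 1 - q, (1 + 3 q)(1 + v) >= (1 + 3 q)(2 - q) = 2 (1 + q) + 3 q (1 - q). *)
  assert (H2 : (2 * (1 + q)) ^ 2 <= ((1 + 3 * q) * (1 + v)) ^ 2) by (apply pow_incr; nra).
  assert (H3 : 2 * q * (1 + s) ^ 2 <= 2 * q * (1 + q) ^ 2) by (apply Rmult_le_compat_l; lra).
  assert (H4 : q / 2 * ((1 + 3 * q) * (1 + v)) ^ 2 <= s * ((1 + 3 * q) * (1 + v)) ^ 2)
    by (apply Rmult_le_compat_r; [apply pow2_ge_0|nra]).
  nra.
Qed.

(** This passes from the squared ratio to the ratio itself; below 1 one has y >= y^2, so the lower
    bound carries over without a root. *)
Lemma Rabs_sqr_sub_1 (y l u : R) : 0 <= y -> 0 <= u -> 0 <= l ->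
  1 - l <= y ^ 2 <= (1 + u) ^ 2 -> Rabs (y - 1) <= l + u.
Proof.
intros Hy Hu Hl [H1 H2]; apply Rabs_le; split.
- destruct (Rle_or_lt 1 y); nra.
- assert (y <= 1 + u); [|lra]; apply Rsqr_incr_0_var; unfold Rsqr; lra.
Qed.

Section Branch.

Variable rstar : R -> R.
Hypothesis rstar_sync : forall K, 2 < K -> sync_level K (rstar K).

(** This is the parameter of the curve at K, that is, the inverse of [coupling]. *)
Definition branch_point (K : R) : R := Defs.f (rstar K) K * rstar K.

Lemma branch_pointP (K : R) : 2 < K ->
  0 < branch_point K /\ V (branch_point K) = rstar K /\ coupling (branch_point K) = K.
Proof. intros HK; apply sync_level_inv, rstar_sync, HK. Qed.

Lemma is_derive_rstar (K : R) : 2 < K ->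
  is_derive rstar K (sensitivity (branch_point K)).
Proof.
intros HK; destruct (branch_pointP K HK) as [Hx _].
(* [rstar] is constrained only for K > 2, so the identity holds only locally. *)
apply (is_derive_ext_loc (fun K => V (branch_point K))).
{ apply (filter_imp (fun z => 2 < z)); [|now apply open_gt].
  intros z Hz; apply branch_pointP, Hz. }
evar_last.
{ apply (is_derive_comp V branch_point).
  - apply is_derive_V_log_slope, Hx.
  - apply (is_derive_inverse coupling dcoupling branch_point 2); trivial.
    + apply is_derive_coupling.
    + apply dcoupling_gt0.
    + apply coupling_lt.
    + intros z Hz; destruct (branch_pointP z Hz) as [H1 [_ H2]]; now split. }
destruct (slope_bounds _ Hx) as [Hv [Hq Hs]].
pose proof (monotonicity_factor_gt0 _ Hx).
unfold scal; simpl; unfold mult; simpl.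
unfold dcoupling, sensitivity; field; repeat split; lra.
Qed.

Lemma is_derive_branch_point (K : R) : 2 < K ->
  is_derive branch_point K (/ dcoupling (branch_point K)).
Proof.
apply (is_derive_inverse coupling dcoupling branch_point 2).
- apply is_derive_coupling.
- apply dcoupling_gt0.
- apply coupling_lt.
- intros z Hz; destruct (branch_pointP z Hz) as [H1 [_ H2]]; now split.
Qed.

Lemma sensitivity_gt0 (x : R) : 0 < x -> 0 < sensitivity x.
Proof.
intros Hx; destruct (slope_bounds x Hx) as [Hv [Hq Hs]].
pose proof (monotonicity_factor_gt0 x Hx).
unfold sensitivity; positivity.
Qed.

Lemma rstar_second_derivative (K : R) : 2 < K ->
  exists d, is_derive (Derive rstar) K d /\ d < 0.
Proof.
intros HK; destruct (branch_pointP K HK) as [Hx _].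
destruct (slope_bounds _ Hx) as [Hv [Hq Hs]].
eexists; split.
- apply (is_derive_ext_loc (fun K => sensitivity (branch_point K))).
  { apply (filter_imp (fun z => 2 < z)); [|now apply open_gt].
    intros z Hz; symmetry; apply is_derive_unique, is_derive_rstar, Hz. }
  apply (is_derive_comp sensitivity branch_point).
  + apply is_derive_sensitivity, Hx.
  + apply is_derive_branch_point, HK.
- unfold scal; simpl; unfold mult; simpl.
  match goal with |- ?a * - (?b * ?c) < 0 => assert (0 < a * (b * c)); [|lra] end.
  apply Rmult_lt_0_compat; [apply Rinv_0_lt_compat, dcoupling_gt0, Hx|].
  apply Rmult_lt_0_compat.
  + pose proof (sensitivity_gt0 _ Hx); pose proof (monotonicity_factor_gt0 _ Hx).
    positivity.
  + apply (convexity_poly_gt0 (1 - V (branch_point K) ^ 2)); trivial.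
    * apply log_slope_ge, Hx.
    * apply log_slope_le_q, Hx.
    * apply log_slope_le_quartic, Hx.
Qed.

Lemma rstar_sqr_bounds (K : R) : 2 < K -> K <= 3 ->
  (K - 2) / 2 * (1 - 2 * (K - 2)) <= rstar K ^ 2 <= (K - 2) / 2.
Proof.
intros HK HK3; destruct (branch_pointP K HK) as [Hx [E1 E2]].
pose proof (V_sqr_le_coupling _ Hx); pose proof (V_sqr_ge_coupling _ Hx).
rewrite E1, E2 in *; lra.
Qed.

Lemma rstar_gt0_lt1 (K : R) : 2 < K -> 0 < rstar K < 1.
Proof. intros HK; apply (rstar_sync K HK). Qed.

Lemma at_right_lt (a b : R) : a < b -> at_right a (fun K => a < K /\ K < b).
Proof.
intros H; unfold at_right, within.
apply (filter_imp (fun K => K < b)); [tauto|now apply open_lt].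
Qed.

Lemma rstar_cvg_0 : filterlim rstar (at_right 2) (locally 0).
Proof.
apply filterlim_locally; intros eps; pose proof (cond_pos eps).
(* The 1 ensures K <= 3 for [rstar_sqr_bounds]; the other term makes r^2 < eps^2. *)
assert (Hd : 2 < 2 + Rmin 1 (eps ^ 2)).
{ assert (0 < Rmin 1 (eps ^ 2)); [|lra].
  apply Rmin_glb_lt; [lra|apply pow_lt; lra]. }
generalize (at_right_lt _ _ Hd); apply filter_imp; intros K [HK HK'].
pose proof (Rmin_l 1 (eps ^ 2)); pose proof (Rmin_r 1 (eps ^ 2)).
pose proof (rstar_sqr_bounds K HK ltac:(lra)); pose proof (rstar_gt0_lt1 K HK).
apply Rabs_def1; unfold minus, plus, opp; simpl; nra.
Qed.

Lemma rstar_asymp_2 : asymp_equiv (at_right 2) rstar (fun K => sqrt ((K - 2) / 2)).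
Proof.
apply filterlim_locally; intros eps; pose proof (cond_pos eps).
(* The squared ratio lies in [1 - 2 (K - 2), 1], so the error is at most 2 (K - 2) < eps. *)
assert (Hd : 2 < 2 + Rmin (1 / 2) (eps / 2)).
{ assert (0 < Rmin (1 / 2) (eps / 2)); [|lra]; apply Rmin_glb_lt; lra. }
generalize (at_right_lt _ _ Hd); apply filter_imp; intros K [HK HK'].
pose proof (Rmin_l (1 / 2) (eps / 2)); pose proof (Rmin_r (1 / 2) (eps / 2)).
pose proof (rstar_sqr_bounds K HK ltac:(lra)) as [Hlo Hhi].
pose proof (rstar_gt0_lt1 K HK) as Hr.
assert (Hb : 0 < sqrt ((K - 2) / 2)) by (apply sqrt_lt_R0; lra).
assert (Hy : (rstar K / sqrt ((K - 2) / 2)) ^ 2 = rstar K ^ 2 / ((K - 2) / 2)).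
{ rewrite <- (sqrt_sqrt ((K - 2) / 2)) at 2 by lra; field; lra. }
apply Rle_lt_trans with (2 * (K - 2) + 0); [|lra].
apply Rabs_sqr_sub_1; try lra.
- apply Rdiv_le_0_compat; lra.
- rewrite Hy; split.
  + apply Rle_div_r; lra.
  + apply Rle_div_l; lra.
Qed.

Lemma p_infty_inv_sqrt_lt (c eps : R) : 0 < c -> 0 < eps ->
  Rbar_locally p_infty (fun K => 2 < K /\ c / sqrt K < eps).
Proof.
intros Hc Heps; exists (2 + (c / eps) ^ 2); intros K HK.
pose proof (pow2_ge_0 (c / eps)).
split; [lra|].
apply Rlt_div_l; [apply sqrt_lt_R0; lra|].
rewrite Rmult_comm; apply Rlt_div_l; trivial.
rewrite <- (sqrt_pow2 (c / eps)) by (apply Rdiv_le_0_compat; lra).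
apply sqrt_lt_1; lra.
Qed.

Lemma one_sub_rstar_sqr_le (K : R) : 2 < K -> 1 - rstar K ^ 2 <= 2 / sqrt K.
Proof.
intros HK; destruct (branch_pointP K HK) as [Hx [E1 E2]].
pose proof (one_sub_V_sqr_le_sqrt_coupling _ Hx) as H; rewrite E1, E2 in H; exact H.
Qed.

Lemma rstar_cvg_1 : filterlim rstar (Rbar_locally p_infty) (locally 1).
Proof.
apply filterlim_locally; intros eps; pose proof (cond_pos eps).
generalize (p_infty_inv_sqrt_lt 2 eps ltac:(lra) ltac:(trivial)).
apply filter_imp; intros K [HK Hlt].
pose proof (one_sub_rstar_sqr_le K HK); pose proof (rstar_gt0_lt1 K HK).
apply Rabs_def1; unfold minus, plus, opp; simpl; nra.
Qed.

Lemma rstar_asymp_p_infty :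
  asymp_equiv (Rbar_locally p_infty) (fun K => 1 - rstar K) (fun K => 1 / (2 * sqrt K)).
Proof.
apply filterlim_locally; intros eps; pose proof (cond_pos eps).
(* 54 = 2 (24 + 3): the error is at most 24 q + 3 q by [coupling_asymp], and q <= 2 / sqrt K. *)
generalize (p_infty_inv_sqrt_lt 54 eps ltac:(lra) ltac:(trivial)).
apply filter_imp; intros K [HK Hlt].
pose proof (one_sub_rstar_sqr_le K HK) as Hq; pose proof (rstar_gt0_lt1 K HK) as Hr.
destruct (branch_pointP K HK) as [Hx [E1 E2]].
pose proof (coupling_asymp _ Hx) as Hy; cbv zeta in Hy; rewrite E1, E2 in Hy.
assert (Hs : 0 < sqrt K) by (apply sqrt_lt_R0; lra).
set (q := 1 - rstar K ^ 2) in *.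
assert (Hq0 : 0 < q) by (unfold q; nra).
apply Rle_lt_trans with (24 * q + 3 * q).
- replace ((1 - rstar K) / (1 / (2 * sqrt K))) with ((1 - rstar K) * (2 * sqrt K))
    by (field; lra).
  apply Rabs_sqr_sub_1; try lra.
  apply Rmult_le_pos; lra.
- replace (54 / sqrt K) with (27 * (2 / sqrt K)) in Hlt by (field; lra); lra.
Qed.

End Branch.

Theorem theorem4p4 :
  (forall K : R, 2 < K -> exists! r : R, sync_level K r) /\
  (forall rstar : R -> R,
    (forall K : R, 2 < K -> sync_level K (rstar K)) ->
    filterlim rstar (at_right 2) (locally 0) /\
    filterlim rstar (Rbar_locally p_infty) (locally 1) /\
    asymp_equiv (at_right 2) rstar (fun K => sqrt ((K - 2) / 2)) /\
    asymp_equiv (Rbar_locally p_infty)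
      (fun K => 1 - rstar K) (fun K => 1 / (2 * sqrt K)) /\
    (forall K : R, 2 < K -> ex_derive rstar K /\ 0 < Derive rstar K) /\
    (forall K : R, 2 < K ->
      ex_derive_n rstar 2 K /\ Derive_n rstar 2 K < 0)).
Proof.
split.
- intros K HK; destruct (coupling_surj K HK) as [x [Hx <-]].
  exists (V x); split; [now apply sync_level_coupling|].
  intros r; apply sync_level_unique, sync_level_coupling, Hx.
- intros rstar Hsync; repeat split.
  + now apply rstar_cvg_0.
  + now apply rstar_cvg_1.
  + now apply rstar_asymp_2.
  + now apply rstar_asymp_p_infty.
  + eexists; now apply is_derive_rstar.
  + rewrite (is_derive_unique _ _ _ (is_derive_rstar rstar Hsync K H)).
    now apply sensitivity_gt0, branch_pointP.
  + destruct (rstar_second_derivative rstar Hsync K H) as [d [Hd _]]; exists d; exact Hd.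
  + destruct (rstar_second_derivative rstar Hsync K H) as [d [Hd Hneg]].
    change (Derive (Derive rstar) K < 0); now rewrite (is_derive_unique _ _ _ Hd).
Qed.
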